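(* Let $\mathcal{H}_K$ be a reproducing kernel Hilbert space of real-valued functions contained in $L^2(\mathbb{R})$, with positive definite kernel $K:\mathbb{R}^2\to\mathbb{R}$ and norm $\|\cdot\|_K$. Assume that $K$ is bounded on $\mathbb{R}^2$ and that there exists a constant $C_1$ such that for any $h\in\mathcal{H}_K$ and all $x,y\in\mathbb{R}$, $$|h(x)-h(y)|\le C_1\|h\|_K\,|x-y|.$$ Let $v=(v_t)_{t\in[0,1]}\in\mathcal{X}^1$ and $\Omega=[0,1]$. Then there exists a unique solution $\phi_t(x)$, $x\in\Omega$, $t\in[0,1]$, of the ordinary differential equation $\frac{d\phi_t}{dt}=v_t(\phi_t)$ with initial condition the identity. Besides, for all $t\in[0,1]$, $\phi_t$ is a homeomorphism from $\Omega$ to $\phi_t(\Omega)$.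
   Context: $\tilde{\mathcal{H}}=\mathrm{Span}\{1,x\}+\mathcal{H}_K$ is the space of functions $\tilde h:\mathbb{R}\to\mathbb{R}$ of the form $\tilde h(x)=a_1+a_2x+h(x)$ with $a_1,a_2\in\mathbb{R}$, $h\in\mathcal{H}_K$. It is a Banach space for the norm $\|\tilde h\|=\max(|a_1|,|a_2|)+\|h\|_K$. A time-dependent vector field is a ($\tilde{\mathcal{H}}$-valued, measurable in $t$) family $v=(v_t)_{t\in[0,1]}$ with $v_t\in\tilde{\mathcal{H}}$ for all $t\in[0,1]$. $\mathcal{X}^1$ is the space of time-dependent vector fields with $\int_0^1\|v_t\|\,dt<+\infty$. A function $t\mapsto\phi_t$ is called a solution of $\frac{d\phi_t}{dt}=v_t(\phi_t)$ with initial condition the identity if for all $x\in\Omega=[0,1]$, $t\mapsto\phi_t(x)$ is a continuous function from $[0,1]$ to $\mathbb{R}$, $\phi_0(x)=x$, and for all $t\in[0,1]$ and $x\in\Omega$, $\phi_t(x)=x+\int_0^t v_s(\phi_s(x))\,ds$. *)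

(* Defs.v *)
From HB Require Import structures.
From mathcomp Require Import all_boot all_order all_algebra.
From mathcomp Require Import all_classical all_reals all_analysis.
From mathcomp Require Import lra.

Set Implicit Arguments.
Unset Strict Implicit.
Unset Printing Implicit Defensive.

Import Order.TTheory GRing.Theory Num.Theory.
Import numFieldNormedType.Exports.

Local Open Scope classical_set_scope.
Local Open Scope ring_scope.

(* The real line with its Lebesgue (not merely Borel) sigma-algebra, which is
   the domain of [completed_lebesgue_measure]. *)
Definition lebesgueR (R : realType) :=
  caratheodory_type ((wlength (idfun : R -> R))^*)%mu.

Notation lambda := (@completed_lebesgue_measure _).

(* "Positive definite" in the sense of reproducing kernels: symmetric, with
   positive semidefinite Gram matrices. *)
Definition positive_definite_kernel (R : realType) (K : R -> R -> R) : Prop :=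
  (forall x y, K x y = K y x) /\
  (forall (n : nat) (x c : 'I_n -> R),
     0 <= \sum_(i < n) \sum_(j < n) c i * c j * K (x i) (x j)).

Definition dot_norm (R : realType) (dot : (R -> R) -> (R -> R) -> R)
  (h : R -> R) : R := Num.sqrt (dot h h).

(* [H] is a Hilbert space of functions for the inner product [dot] (which is
   only meaningful on [H]), with reproducing kernel [K]. *)
Record is_rkhs (R : realType) (K : R -> R -> R) (H : set (R -> R))
    (dot : (R -> R) -> (R -> R) -> R) : Prop := IsRKHS {
  rkhs_zero : H (fun=> 0) ;
  rkhs_linear : forall (a : R) f g, H f -> H g -> H (fun x => a * f x + g x) ;
  rkhs_dotC : forall f g, H f -> H g -> dot f g = dot g f ;
  rkhs_dot_linear : forall (a : R) f g h, H f -> H g -> H h ->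
    dot (fun x => a * f x + g x) h = a * dot f h + dot g h ;
  rkhs_dot_ge0 : forall f, H f -> 0 <= dot f f ;
  rkhs_dot_eq0 : forall f, H f -> dot f f = 0 -> f = (fun=> 0) ;
  rkhs_complete : forall u : nat -> R -> R, (forall n, H (u n)) ->
    (forall e, 0 < e -> exists N, forall m n, (N <= m)%N -> (N <= n)%N ->
       dot_norm dot (u m \- u n) < e) ->
    exists2 f, H f & (fun n => dot_norm dot (u n \- f)) @ \oo --> (0 : R) ;
  rkhs_kernel : forall x, H (K x) ;
  rkhs_reproducing : forall f x, H f -> f x = dot f (K x) }.

Definition contained_in_L2 (R : realType) (H : set (R -> R)) : Prop :=
  forall h, H h -> (h : lebesgueR R -> R) \in Lfun lambda 2%:E.

Definition tilde (R : realType) (H : set (R -> R)) : set (R -> R) :=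
  [set f | exists a1 a2 h, H h /\ f = (fun x => a1 + a2 * x + h x)].

(* The norm max(|a1|,|a2|) + ||h||, read off the decomposition
   f = a1 + a2 x + h; the latter is unique when [H] is a subspace contained in
   L^2, see [tilde_normE]. Junk value 0 outside of [tilde H]. *)
Definition tilde_norm (R : realType) (H : set (R -> R))
    (dot : (R -> R) -> (R -> R) -> R) (f : R -> R) : R :=
  xget 0 [set r | exists a1 a2 h,
    [/\ H h, f = (fun x => a1 + a2 * x + h x) &
        r = Num.max `|a1| `|a2| + dot_norm dot h]].

Lemma affine_L2_eq0 (R : realType) (a b : R) :
  ((fun x => a + b * x) : lebesgueR R -> R) \in Lfun lambda 2%:E ->
  a = 0 /\ b = 0.
Proof.
move=> /Lfun2_integrable_sqr /integrableP[mf].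
under eq_integral do rewrite /= ger0_norm ?sqr_ge0//.
move=> fin.
have key (c r : R) : 0 < r ->
    (forall x, c <= x -> r <= (a + b * x) ^+ 2) -> False.
  move=> r0 rle.
  have mD : measurable (`[c, +oo[%classic : set (lebesgueR R)).
    by apply: sub_caratheodory; exact: measurable_itv.
  have muD : lambda (`[c, +oo[%classic : set (lebesgueR R)) = +oo%E.
    by have := lebesgue_measure_itv `[c, +oo[; rewrite /= ltry addye.
  have : (\int[lambda]_(x in (`[c, +oo[%classic : set (lebesgueR R))) r%:E <=
          \int[lambda]_x ((a + b * x) ^+ 2)%:E)%E.
    apply: (@le_trans _ _ (\int[lambda]_(x in
      (`[c, +oo[%classic : set (lebesgueR R))) ((a + b * x) ^+ 2)%:E))%E.
      apply: ge0_le_integral => //=.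
      - by move=> _ _; exact: ltW.
      - exact: measurable_funS mf.
      - by move=> x /=; rewrite in_itv/= andbT lee_fin => /rle.
    apply: ge0_subset_integral => //=.
    by move=> *; rewrite lee_fin sqr_ge0.
  rewrite integral_cst// [X in (_ * X)%E](_ : _ = +oo%E); last exact: muD.
  rewrite mulry gtr0_sg// mul1e leye_eq => /eqP E.
  by move: fin; rewrite E ltxx.
have b0 : b = 0.
  apply/eqP/negPn/negP => b0.
  apply: (key ((1 + `|a|) / `|b|) 1) => // x xc.
  have nb : 0 < `|b| by rewrite normr_gt0.
  have x0 : 0 <= x by apply: le_trans xc; rewrite divr_ge0// addr_ge0.
  rewrite -real_normK ?num_real// exprn_ege1//.
  move: xc; rewrite ler_pdivrMr// => xc.
  rewrite addrC -[a]opprK (le_trans _ (lerB_dist _ _))// normrN normrM.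
  by rewrite (ger0_norm x0) lerBrDr mulrC.
split => //; apply/eqP/negPn/negP => a0.
apply: (key 0 (a ^+ 2)) => [|x _]; first by rewrite exprn_even_gt0.
by rewrite b0 mul0r addr0.
Qed.

Lemma tilde_normE (R : realType) (K : R -> R -> R) (H : set (R -> R))
    (dot : (R -> R) -> (R -> R) -> R) (a1 a2 : R) (h : R -> R) :
  is_rkhs K H dot -> contained_in_L2 H -> H h ->
  tilde_norm H dot (fun x => a1 + a2 * x + h x) =
  Num.max `|a1| `|a2| + dot_norm dot h.
Proof.
move=> rk HL2 Hh; apply: xget_unique; first by exists a1, a2, h.
move=> _ [b1 [b2 [g [Hg eq_f ->]]]].
have eqx x : a1 + a2 * x + h x = b1 + b2 * x + g x.
  exact: (congr1 (fun f => f x) eq_f).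
have : H (fun x => -1 * h x + g x) by exact: rkhs_linear rk _ _ _ Hh Hg.
have -> : (fun x => -1 * h x + g x) = (fun x => (a1 - b1) + (a2 - b2) * x).
  by apply/funext => x; have := eqx x; lra.
move=> /HL2/affine_L2_eq0[/subr0_eq e1 /subr0_eq e2].
suff -> : g = h by rewrite e1 e2.
by apply/funext => x; have := eqx x; rewrite e1 e2 => /addrI.
Qed.

Definition tilde_open (R : realType) (H : set (R -> R))
    (dot : (R -> R) -> (R -> R) -> R) (U : set (R -> R)) : Prop :=
  forall f, tilde H f -> U f ->
    exists2 e : R, 0 < e &
      forall g, tilde H g -> tilde_norm H dot (g \- f) < e -> U g.

(* The space X^1. The field [v] is only considered for times in [0, 1];
   measurability is with respect to the Lebesgue sigma-algebra on [0, 1] and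
   the Borel sigma-algebra of the norm of [tilde H]. *)
Definition X1 (R : realType) (H : set (R -> R))
    (dot : (R -> R) -> (R -> R) -> R) (v : R -> R -> R) : Prop :=
  [/\ forall t : R, 0 <= t <= 1 -> tilde H (v t),
      forall U, tilde_open H dot U ->
        measurable ([set t | 0 <= t <= 1 /\ U (v t)] : set (lebesgueR R)) &
      (\int[lambda]_(t in `[0%R, 1%R]) (tilde_norm H dot (v t))%:E < +oo)%E].

(* [phi t x] is a solution on times and positions in [0, 1] of the integral
   equation. As [Rintegral] is a total function, the existence of the integral
   is a separate clause. *)
Definition is_solution (R : realType) (v phi : R -> R -> R) : Prop :=
  forall x : R, 0 <= x <= 1 ->
  [/\ {within `[0, 1], continuous (fun t => phi t x)},
      phi 0 x = x &
      forall t : R, 0 <= t <= 1 ->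
        lambda.-integrable (`[0, t]%classic : set (lebesgueR R))
          (fun s => (v s (phi s x))%:E) /\
        phi t x = x + \int[lambda]_(s in `[0, t]) v s (phi s x)].

Definition homeomorphism_onto_image (T U : topologicalType) (A : set T)
    (f : T -> U) : Prop :=
  {within A, continuous f} /\
  exists2 g : U -> T, {within f @` A, continuous g} & {in A, cancel f g}.

(* Main.v *)
(* Put k(t) = L ||v_t||. Boundedness of the kernel and the Lipschitz hypothesis
   give |v_t(x)| <= k(t) (1 + |x|) and |v_t(x) - v_t(y)| <= k(t) |x - y| with k
   integrable, and both ||v_t|| and v_t(x) are measurable in t because their
   strict sublevel sets are open in the normed space: this is a Caratheodory
   equation. Everything else follows from one two-sided Gronwall estimate: if f
   is continuous and nonnegative on [0, 1] with |f(t) - f(s)| <= int_s^t k f,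
   then f(t) <= C f(s) for all s, t in either order, with C depending only on k.
   Applied to the distance between two solutions it gives uniqueness and shows
   that phi_t is bi-Lipschitz; applied to 1 + |x| plus the accumulated variation
   of the Picard iterates it shows that these converge. *)
Require Import Defs.
From HB Require Import structures.
From mathcomp Require Import all_boot all_order all_algebra.
From mathcomp Require Import all_classical all_reals all_analysis.
From mathcomp Require Import measurable_realfun.
From mathcomp Require Import lra ring.

Set Implicit Arguments.
Unset Strict Implicit.
Unset Printing Implicit Defensive.

Import Order.TTheory GRing.Theory Num.Theory.
Import numFieldNormedType.Exports.

Local Open Scope classical_set_scope.
Local Open Scope ring_scope.

(** * Inner product, Cauchy-Schwarz and point evaluation in $\mathcal{H}_K$ *)

Section RKHS.
Context (R : realType) (K : R -> R -> R) (H : set (R -> R)).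
Context (dot : (R -> R) -> (R -> R) -> R).
Hypothesis H_rkhs : is_rkhs K H dot.
Implicit Types (f g h : R -> R) (a : R).

Lemma rkhsZD a f g : H f -> H g -> H (fun x => a * f x + g x).
Proof. exact: rkhs_linear H_rkhs _ _ _. Qed.

Lemma rkhsD f g : H f -> H g -> H (fun x => f x + g x).
Proof.
by move=> Hf /(rkhsZD 1 Hf); under eq_fun do rewrite mul1r.
Qed.

Lemma rkhsB f g : H f -> H g -> H (fun x => f x - g x).
Proof.
move=> Hf Hg; have := rkhsZD (-1) Hg Hf.
by under eq_fun do rewrite mulN1r addrC.
Qed.

Lemma dotZDr a f g h : H f -> H g -> H h ->
  dot h (fun x => a * f x + g x) = a * dot h f + dot h g.
Proof.
move=> Hf Hg Hh; rewrite (rkhs_dotC H_rkhs Hh (rkhsZD a Hf Hg)).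
rewrite (rkhs_dot_linear H_rkhs)//.
by rewrite (rkhs_dotC H_rkhs Hf Hh) (rkhs_dotC H_rkhs Hg Hh).
Qed.

Lemma dot_sqrZD a f g : H f -> H g ->
  dot (fun x => a * f x + g x) (fun x => a * f x + g x) =
  a ^+ 2 * dot f f + 2 * a * dot f g + dot g g.
Proof.
move=> Hf Hg; rewrite dotZDr//; last exact: rkhsZD.
rewrite (rkhs_dotC H_rkhs (rkhsZD a Hf Hg) Hf).
rewrite (rkhs_dotC H_rkhs (rkhsZD a Hf Hg) Hg) !dotZDr//.
by rewrite (rkhs_dotC H_rkhs Hg Hf); lra.
Qed.

Lemma dot_norm_ge0 f : 0 <= dot_norm dot f.
Proof. exact: sqrtr_ge0. Qed.

Lemma sqr_dot_norm f : H f -> dot_norm dot f ^+ 2 = dot f f.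
Proof. by move=> Hf; rewrite sqr_sqrtr// (rkhs_dot_ge0 H_rkhs). Qed.

(** The squared norm of $g - (\langle f,g\rangle/\langle f,f\rangle) f$ is nonnegative. The case
    $\langle f,f\rangle = 0$ is treated apart. *)
Lemma cauchy_schwarz_dot f g : H f -> H g ->
  `|dot f g| <= dot_norm dot f * dot_norm dot g.
Proof.
move=> Hf Hg.
have ff := rkhs_dot_ge0 H_rkhs Hf; have gg := rkhs_dot_ge0 H_rkhs Hg.
rewrite -sqrtrM// -sqrtr_sqr ler_sqrt ?mulr_ge0//.
have [f0|f0] := eqVneq (dot f f) 0.
  (* Here $f$ is the zero function, so $1 \cdot f + f = f$, and linearity gives $\langle f,g\rangle
     = 2\langle f,g\rangle$ at $g = f$-independent cost. *)
  suff -> : dot f g = 0 by rewrite expr0n f0 mul0r.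
  have fE := rkhs_dot_eq0 H_rkhs Hf f0.
  have := rkhs_dot_linear H_rkhs 1 Hf Hf Hg.
  have -> : (fun x => 1 * f x + f x) = f.
    by apply/funext => x; rewrite fE; lra.
  by lra.
have f_gt0 : 0 < dot f f by rewrite lt_def f0.
have := rkhs_dot_ge0 H_rkhs (rkhsZD (- (dot f g / dot f f)) Hf Hg).
rewrite dot_sqrZD//.
(* Multiplied by $\langle f,f\rangle$, the squared norm becomes $\langle f,f\rangle\langle
   g,g\rangle - \langle f,g\rangle^2$. *)
move=> /(mulr_ge0 ff); rewrite -[in X in _ -> X]subr_ge0.
by congr (0 <= _); field.
Qed.

Lemma dot_normD f g : H f -> H g ->
  dot_norm dot (fun x => f x + g x) <= dot_norm dot f + dot_norm dot g.
Proof.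
move=> Hf Hg; rewrite -[leRHS]ger0_norm ?addr_ge0 ?dot_norm_ge0//.
rewrite -sqrtr_sqr ler_sqrt ?sqr_ge0//.
have := @dot_sqrZD 1 f g Hf Hg; under eq_fun do rewrite mul1r.
move=> ->; have := le_trans (ler_norm _) (cauchy_schwarz_dot Hf Hg).
rewrite -(sqr_dot_norm Hf) -(sqr_dot_norm Hg); lra.
Qed.

(** By the reproducing property $f(x) = \langle f, K_x\rangle$, and $\|K_x\|_K^2 = K(x,x) \le M$. *)
Lemma rkhs_eval_le (M : R) f x : (forall y z, `|K y z| <= M) -> H f ->
  `|f x| <= Num.sqrt M * dot_norm dot f.
Proof.
move=> KM Hf; have HK := rkhs_kernel H_rkhs x.
rewrite (rkhs_reproducing H_rkhs x Hf) (le_trans (cauchy_schwarz_dot Hf HK))//.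
rewrite mulrC ler_wpM2r ?dot_norm_ge0//.
have M0 : 0 <= M by apply: le_trans (KM x x).
by rewrite ler_sqrt// -(rkhs_reproducing H_rkhs x HK) (le_trans (ler_norm _)).
Qed.

(** * The normed space $\tilde{\mathcal{H}}$: growth and Lipschitz bounds, open sublevel sets *)

Hypothesis H_L2 : contained_in_L2 H.

Lemma tildeP f : tilde H f -> exists a1 a2 h,
  [/\ H h, f = (fun x => a1 + a2 * x + h x) &
   tilde_norm H dot f = Num.max `|a1| `|a2| + dot_norm dot h].
Proof.
move=> [a1 [a2 [h [Hh ->]]]]; exists a1, a2, h; split => //.
exact: tilde_normE H_rkhs H_L2 Hh.
Qed.

Lemma tilde_norm_ge0 f : tilde H f -> 0 <= tilde_norm H dot f.
Proof.
move=> /tildeP[a1 [a2 [h [_ _ ->]]]].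
by rewrite addr_ge0 ?dot_norm_ge0// le_max normr_ge0.
Qed.

Lemma tildeB f g : tilde H f -> tilde H g -> tilde H (g \- f).
Proof.
move=> [a1 [a2 [h [Hh ->]]]] [b1 [b2 [k [Hk ->]]]].
exists (b1 - a1), (b2 - a2), (fun x => k x - h x); split; first exact: rkhsB.
by apply/funext => x /=; ring.
Qed.

Lemma tilde_normD f g : tilde H f -> tilde H g ->
  tilde_norm H dot (f \+ g) <= tilde_norm H dot f + tilde_norm H dot g.
Proof.
move=> /tildeP[a1 [a2 [h [Hh -> ->]]]] /tildeP[b1 [b2 [k [Hk -> ->]]]].
have -> : (fun x => a1 + a2 * x + h x) \+ (fun x => b1 + b2 * x + k x) =
    (fun x => (a1 + b1) + (a2 + b2) * x + (h x + k x)).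
  by apply/funext => x /=; ring.
rewrite (tilde_normE _ _ H_rkhs H_L2 (rkhsD Hh Hk)) addrACA.
rewrite lerD ?dot_normD// ge_max.
by rewrite !(le_trans (ler_normD _ _))// lerD// le_max lexx ?orbT.
Qed.

Lemma tilde_eval_le (M : R) f x : (forall y z, `|K y z| <= M) -> tilde H f ->
  `|f x| <= (1 + Num.sqrt M) * (1 + `|x|) * tilde_norm H dot f.
Proof.
move=> KM /tildeP[a1 [a2 [h [Hh -> ->]]]]; set m := Num.max _ _.
have am1 : `|a1| <= m by rewrite le_max lexx.
have am2 : `|a2| <= m by rewrite le_max lexx orbT.
have hM := rkhs_eval_le x KM Hh; have n0 := dot_norm_ge0 h.
have m0 : 0 <= m by exact: le_trans am1.
rewrite (le_trans (ler_normD _ _))// (le_trans (lerD (ler_normD _ _) hM))//.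
rewrite normrM; have x0 := normr_ge0 x; have s0 := sqrtr_ge0 M.
have a2x : `|a2| * `|x| <= m * `|x| by rewrite ler_wpM2r.
have sm : 0 <= Num.sqrt M * m by rewrite mulr_ge0.
have smx : 0 <= Num.sqrt M * m * `|x| by rewrite mulr_ge0.
have snx : 0 <= Num.sqrt M * dot_norm dot h * `|x| by rewrite !mulr_ge0.
have nx : 0 <= dot_norm dot h * `|x| by rewrite mulr_ge0.
lra.
Qed.

(** The sign of [C] is not assumed, hence the absolute value in the constant; the summand 1 pays for
    the slope [a2]. *)
Lemma tilde_lip_le (C : R) f x y :
    (forall h x y, H h -> `|h x - h y| <= C * dot_norm dot h * `|x - y|) ->
  tilde H f ->
  `|f x - f y| <= (1 + `|C|) * tilde_norm H dot f * `|x - y|.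
Proof.
move=> HC /tildeP[a1 [a2 [h [Hh -> ->]]]]; set m := Num.max _ _.
have am2 : `|a2| <= m by rewrite le_max lexx orbT.
have n0 := dot_norm_ge0 h; have m0 : 0 <= m by exact: le_trans am2.
have -> : a1 + a2 * x + h x - (a1 + a2 * y + h y) = a2 * (x - y) + (h x - h y).
  by ring.
rewrite (le_trans (ler_normD _ _))// normrM.
rewrite (le_trans (lerD (lexx _) (HC _ _ _ Hh)))// -mulrDl ler_wpM2r//.
have : C * dot_norm dot h <= `|C| * dot_norm dot h.
  by rewrite ler_wpM2r// ler_norm.
have : 0 <= `|C| * m by rewrite mulr_ge0.
lra.
Qed.

(** With the next lemma, this turns Borel measurability of the field into measurability of real
    functions of time. *)
Lemma tilde_open_norm_lt (c : R) :
  tilde_open H dot [set f | tilde_norm H dot f < c].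
Proof.
move=> f tf /= fc; exists (c - tilde_norm H dot f); rewrite ?subr_gt0//.
move=> g tg gf; have -> : g = (g \- f) \+ f.
  by apply/funext => x /=; rewrite subrK.
rewrite (le_lt_trans (tilde_normD (tildeB tf tg) tf))//; lra.
Qed.

Lemma tilde_open_eval_lt (M c x : R) : (forall y z, `|K y z| <= M) ->
  tilde_open H dot [set f | f x < c].
Proof.
move=> KM f tf /= fc; set A := (1 + Num.sqrt M) * (1 + `|x|).
have A0 : 0 < A by rewrite mulr_gt0// ltr_pwDl// sqrtr_ge0.
exists ((c - f x) / A); first by rewrite divr_gt0// subr_gt0.
move=> g tg; rewrite ltr_pdivlMr// mulrC => gf.
have := tilde_eval_le x KM (tildeB tf tg).
move=> /(le_trans (ler_norm _))/le_lt_trans/(_ gf) /=; lra.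
Qed.

End RKHS.

(** * Bi-Lipschitz maps are homeomorphisms onto their image *)

Lemma within_continuous_dist (R : realType) (A : set R) (f : R -> R) :
  (forall x, A x -> forall e, 0 < e -> exists2 d, 0 < d &
     forall y, A y -> `|x - y| < d -> `|f x - f y| < e) ->
  {within A, continuous f}.
Proof.
move=> h; apply/subspace_continuousP => x Ax; apply/cvgrPdist_lt => e e0.
have [d d0 hd] := h x Ax e e0.
rewrite near_withinE; apply: filterS (nbhsx_ballx x d d0) => y xyd Ay.
exact: hd.
Qed.

Lemma bilipschitz_homeomorphism (R : realType) (A : set R) (f : R -> R) (C : R) :
    0 < C ->
    (forall x y, A x -> A y -> `|f x - f y| <= C * `|x - y|) ->
    (forall x y, A x -> A y -> `|x - y| <= C * `|f x - f y|) ->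
  homeomorphism_onto_image A f.
Proof.
move=> C0 fC fV.
have lip_cont (B : set R) (g : R -> R) :
    (forall x y, B x -> B y -> `|g x - g y| <= C * `|x - y|) ->
    {within B, continuous g}.
  move=> gC; apply: within_continuous_dist => x Bx e e0.
  exists (e / C); first exact: divr_gt0.
  move=> y By; rewrite ltr_pdivlMr// mulrC; apply: le_lt_trans; exact: gC.
split; first exact: lip_cont.
(* The lower bound makes [f] injective on [A], so [xget] picks the unique preimage; its default 0 is
   only taken outside the image. *)
have fK : {in A, cancel f (fun y => xget 0 [set x | A x /\ f x = y])}.
  move=> x /set_mem Ax; apply: xget_unique => // y [Ay fyx].
  have := fV _ _ Ax Ay; rewrite fyx subrr normr0 mulr0 normr_le0 subr_eq0.
  by move/eqP.
exists (fun y => xget 0 [set x | A x /\ f x = y]) => //.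
apply: lip_cont => _ _ [x Ax <-] [y Ay <-].
by rewrite !fK ?inE//; exact: fV.
Qed.

(** * Integrals over subintervals of $[0,1]$ *)

Section indefinite_integral.
Context (R : realType).
Notation T := (lebesgueR R).
Notation I01 := (`[0%R, 1%R]%classic : set T).
Implicit Types (f g : R -> R) (a b s t : R).

Lemma measurable_itv_lebesgueR (i : interval R) : measurable ([set` i] : set T).
Proof. by apply: sub_caratheodory; exact: measurable_itv. Qed.
Hint Resolve measurable_itv_lebesgueR : core.

Lemma lambda_itvoc a b : a <= b ->
  lambda (`]a, b]%classic : set T) = (b - a)%:E.
Proof.
move=> ab; have := lebesgue_measure_itv `]a, b]; rewrite /= lte_fin => E.
apply: eq_trans E _; case: ltP => // ba.
by have -> : a = b; [apply/le_anti; rewrite ab|rewrite subrr].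
Qed.

Lemma within_continuous_measurable f :
  {within `[0, 1], continuous f} -> measurable_fun I01 (f : T -> R).
Proof.
move=> cf mD Y mY; apply: sub_caratheodory.
exact: (subspace_continuous_measurable_fun (measurable_itv _) cf).
Qed.

Lemma within_continuous_bounded f : {within `[0, 1], continuous f} ->
  exists B, forall t, 0 <= t <= 1 -> `|f t| <= B.
Proof.
move=> cf; have [|c _ cP] := @EVT_max R (fun t => `|f t|) 0 1 ler01.
  by move=> x; apply: cvg_norm; exact: cf.
by exists `|f c| => t t01; apply: cP; rewrite in_itv.
Qed.

Lemma subset_itv01 s t : 0 <= s -> t <= 1 -> `]s, t] `<=` I01.
Proof.
move=> s0 t1 u /=; rewrite !in_itv/= => /andP[su ut].
by rewrite (le_trans s0 (ltW su)) (le_trans ut).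
Qed.

Lemma subset_itv0 t : t <= 1 -> (`[0, t]%classic : set T) `<=` I01.
Proof.
by move=> t1 u /=; rewrite !in_itv/= => /andP[-> ut]; rewrite (le_trans ut).
Qed.

Lemma integrable_subitv f (A : set T) : measurable A -> A `<=` I01 ->
  lambda.-integrable I01 (EFin \o f) -> lambda.-integrable A (EFin \o f).
Proof. by move=> mA sA; apply: integrableS. Qed.

Lemma Rintegral_itv0_split f s t : 0 <= s -> s <= t -> t <= 1 ->
    lambda.-integrable I01 (EFin \o f) ->
  \int[lambda]_(u in (`[0, t]%classic : set T)) f u =
  \int[lambda]_(u in (`[0, s]%classic : set T)) f u +
  \int[lambda]_(u in (`]s, t]%classic : set T)) f u.
Proof.
move=> s0 st t1 intf.
have E : (`[0, t]%classic : set T) = (`[0, s]%classic : set T) `|` `]s, t]%classic.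
  by rewrite -itv_bndbnd_setU// bnd_simp.
rewrite {1}E Rintegral_setU//.
- rewrite -E; apply: integrable_subitv intf => //; exact: subset_itv0.
- apply/disj_setPS => u [] /=; rewrite !in_itv/= => /andP[_ us] /andP[su _].
  by move: (lt_le_trans su us); rewrite ltxx.
Qed.

Lemma Rintegral_itv00 f : lambda.-integrable I01 (EFin \o f) ->
  \int[lambda]_(u in (`[0, 0]%classic : set T)) f u = 0.
Proof.
move=> intf; rewrite /Rintegral null_set_integral//.
  apply: measurable_funS (measurable_int _ intf) => //.
  by apply: subset_itv0; exact: ler01.
by have := lebesgue_measure_itv `[0 : R, 0]; rewrite /= ltxx.
Qed.

(** Absolute continuity of the integral, uniform in the position of the interval. *)
Lemma Rintegral_itv_small f e : lambda.-integrable I01 (EFin \o f) -> 0 < e ->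
  exists2 d, 0 < d & forall s t, 0 <= s -> s <= t -> t <= 1 -> t - s < d ->
    \int[lambda]_(u in (`]s, t]%classic : set T)) `|f u| < e.
Proof.
move=> intf e0.
(* Extend [f] by zero to the whole line; on []s, t]] the extension agrees with [f]. *)
have : lambda.-integrable setT (EFin \o (f \_ I01)).
  by rewrite -restrict_EFin; apply/integrable_restrict => //=; rewrite setTI.
move=> /integral_normr_continuous/(_ e e0)[d [d0 dP]].
exists d => // s t s0 st t1 std.
rewrite (_ : Rintegral _ _ _ =
    \int[lambda]_(u in (`]s, t]%classic : set T)) `|(f \_ I01) u|); last first.
  apply: eq_Rintegral => u /set_mem ust; rewrite patchE mem_set//.
  exact: subset_itv01 ust.
by apply: dP => //; rewrite [ltLHS](lambda_itvoc st).
Qed.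

Lemma integrableM_bounded k g (B : R) : lambda.-integrable I01 (EFin \o k) ->
    measurable_fun I01 (g : T -> R) -> (forall t, 0 <= t <= 1 -> `|g t| <= B) ->
  lambda.-integrable I01 (EFin \o (fun t => k t * g t)).
Proof.
move=> ik mg gB; have mk := measurable_int _ ik.
apply: (@le_integrable _ _ _ lambda I01 _ _ (fun t => B%:E * (k t)%:E)%E) => //.
- by apply/measurable_EFinP/measurable_funM => //; exact/measurable_EFinP.
- move=> t; rewrite /= in_itv/= => /gB gtB.
  rewrite lee_fin !normrM mulrC ler_wpM2r//.
  by rewrite (le_trans gtB)// ler_norm.
- exact: integrableZl.
Qed.

Lemma continuous_indefinite_integral f : lambda.-integrable I01 (EFin \o f) ->
  {within `[0, 1],
    continuous (fun t => \int[lambda]_(u in (`[0, t]%classic : set T)) f u)}.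
Proof.
move=> intf; apply: within_continuous_dist => x; rewrite /= in_itv/= => x01 e e0.
have [d d0 dP] := Rintegral_itv_small intf e0; exists d => // y.
rewrite in_itv/=; move: x y x01.
suff h x y : x <= y -> 0 <= x <= 1 -> 0 <= y <= 1 -> `|x - y| < d ->
  `|\int[lambda]_(u in (`[0, x]%classic : set T)) f u -
    \int[lambda]_(u in (`[0, y]%classic : set T)) f u| < e.
  move=> x y x01 y01 xyd; have [xy|/ltW yx] := leP x y; first exact: h.
  by rewrite distrC h// distrC.
move=> xy /andP[x0 x1] /andP[y0 y1].
have -> : `|x - y| = y - x by rewrite distrC ger0_norm ?subr_ge0.
move=> yxd.
rewrite distrC (Rintegral_itv0_split x0 xy y1 intf) addrC addKr.
have intf' : lambda.-integrable (`]x, y]%classic : set T) (EFin \o f).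
  by apply: integrable_subitv intf => //; exact: subset_itv01.
by apply: le_lt_trans (le_normr_Rintegral _ intf') _ => //; exact: dP.
Qed.

End indefinite_integral.

(** * The two-sided Gronwall estimate *)

Section gronwall.
Context (R : realType).
Notation T := (lebesgueR R).
Notation I01 := (`[0%R, 1%R]%classic : set T).
Variable k : R -> R.
Hypothesis k_ge0 : forall t, 0 <= t <= 1 -> 0 <= k t.
Hypothesis ik : lambda.-integrable I01 (EFin \o k).
Implicit Types (f : R -> R) (s t : R).

(** Bounding the absolute value of the increment, not just the increment, is what lets the estimate
    run backwards in time as well. *)
Definition gronwall_hyp f :=
  [/\ {within `[0, 1], continuous f},
      forall t, 0 <= t <= 1 -> 0 <= f t &
      forall s t, 0 <= s -> s <= t -> t <= 1 -> `|f t - f s| <=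
        \int[lambda]_(u in (`]s, t]%classic : set T)) (k u * f u)].

(** Let [k] have integral below 1/2 on an interval containing [s] and [t], and let [f] be maximal
    there at [c]. Then $|f(c)-f(s)| \le f(c)/2$, so $f(t) \le f(c) \le 2f(s)$. The length [d]
    depends on [k] only. *)
Let gronwall_step : exists2 d : R, 0 < d & forall f, gronwall_hyp f ->
  forall s t, 0 <= s <= 1 -> 0 <= t <= 1 -> `|s - t| < d -> f t <= 2 * f s.
Proof.
have [//|d d0 dP] := Rintegral_itv_small ik (e := 2^-1).
exists d => // f [cf f0 fk] s t s01 t01 std.
set a := Num.min s t; set b := Num.max s t.
have ab : a <= b by rewrite ge_min !le_max lexx.
have a0 : 0 <= a by rewrite le_min; lra.
have b1 : b <= 1 by rewrite ge_max; lra.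
have [sab tab] : a <= s <= b /\ a <= t <= b.
  by rewrite !ge_min !le_max !lexx !orbT.
have bad : b - a < d.
  by move: std; rewrite /a /b; case: (leP s t) => st; [rewrite distrC|];
    rewrite ger0_norm// subr_ge0// ltW.
have [|c] := @EVT_max R f a b ab.
  apply: continuous_subspaceW cf => u /=; rewrite !in_itv/= => /andP[au ub].
  by rewrite (le_trans a0)// (le_trans ub).
rewrite in_itv/= => cab cP.
have fc u : a <= u <= b -> f u <= f c by move=> uab; apply: cP; rewrite in_itv.
(* Under the integral [f] is replaced by its maximum [f c], which leaves [f c] times the integral of
   [k]. *)
have key p q : a <= p -> p <= q -> q <= b -> `|f q - f p| <= f c / 2.
  move=> ap pq qb.
  have p0 : 0 <= p by exact: le_trans ap.
  have q1 : q <= 1 by exact: le_trans b1.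
  have c01 : 0 <= c <= 1 by move: cab; lra.
  have pq01 : (`]p, q]%classic : set T) `<=` I01 by exact: subset_itv01.
  have mpq := measurable_itv_lebesgueR `]p, q].
  have ik' := integrable_subitv mpq pq01 ik.
  have [B fB] := within_continuous_bounded cf.
  have ikf := integrable_subitv mpq pq01
    (integrableM_bounded ik (within_continuous_measurable cf) fB).
  apply: le_trans (fk _ _ p0 pq q1) _.
  apply: (@le_trans _ _ (\int[lambda]_(u in (`]p, q]%classic : set T)) (f c * k u))).
    apply: le_Rintegral => //.
      exact: (integrableZl mpq (f c) ik').
    move=> u pqu; have := pq01 _ pqu; rewrite /= in_itv/= => u01.
    move: pqu; rewrite /= in_itv/= => /andP[pu uq].
    rewrite mulrC ler_wpM2r ?k_ge0//; apply: fc.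
    by rewrite (le_trans ap (ltW pu)) (le_trans uq).
  rewrite RintegralZl// ler_wpM2l ?f0//.
  apply: le_trans (ltW (dP _ _ p0 pq q1 _)).
    apply: le_Rintegral => //; first exact: (integrable_abse ik').
    by move=> u _; exact: ler_norm.
  by apply: le_lt_trans bad; rewrite lerB.
have fcs : `|f c - f s| <= f c / 2.
  case: (leP s c) => [sc|/ltW cs].
    by apply: key => //; [move: sab|move: cab]; lra.
  by rewrite distrC; apply: key => //; [move: cab|move: sab]; lra.
have := fc t tab; have := le_trans (ler_norm _) fcs; lra.
Qed.

(* Cut the interval between s and t into pieces over which k has integral less
   than 1/2; each piece costs a factor 2. *)
Lemma gronwall : exists2 C : R, 0 < C & forall f, gronwall_hyp f ->
  forall s t, 0 <= s <= 1 -> 0 <= t <= 1 -> f t <= C * f s.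
Proof.
have [d d0 dP] := gronwall_step.
(* Pieces of length at most [d / 2] satisfy the strict bound required by a single step. *)
have d20 : 0 < d / 2 by rewrite divr_gt0.
have step f : gronwall_hyp f -> forall (n : nat) s t,
    0 <= s <= 1 -> 0 <= t <= 1 -> `|s - t| <= n%:R * (d / 2) ->
    f t <= 2 ^+ n * f s.
  move=> fg; elim=> [|n IH] s t s01 t01.
    by rewrite mul0r normr_le0 subr_eq0 => /eqP ->; rewrite mul1r.
  (* The point [r] divides the way from [s] to [t] in the ratio [n] to 1: the induction hypothesis
     covers [s] to [r], a single step covers [r] to [t]. *)
  move=> std; pose c : R := n%:R / n.+1%:R.
  have n10 : 0 < n.+1%:R :> R by rewrite ltr0n.
  have c0 : 0 <= c by rewrite divr_ge0.
  have c1 : 0 <= 1 - c.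
    by rewrite subr_ge0 ler_pdivrMr// mul1r ler_nat.
  pose r := (1 - c) * s + c * t.
  have r01 : 0 <= r <= 1.
    have [s0 s1] : 0 <= s /\ 0 <= 1 - s by lra.
    have [t0 t1] : 0 <= t /\ 0 <= 1 - t by lra.
    rewrite addr_ge0 ?mulr_ge0//= -subr_ge0.
    have -> : 1 - r = (1 - c) * (1 - s) + c * (1 - t) by rewrite /r; ring.
    by rewrite addr_ge0 ?mulr_ge0.
  have sr : `|s - r| <= n%:R * (d / 2).
    have -> : s - r = c * (s - t) by rewrite /r; ring.
    rewrite normrM (ger0_norm c0) /c mulrAC ler_pdivrMr//.
    by rewrite -mulrA ler_wpM2l// (le_trans std)// mulrC.
  have rt : `|r - t| < d.
    have -> : r - t = (s - t) / n.+1%:R.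
      by rewrite /r /c -(natr1 n); field; rewrite natr1 gt_eqF.
    rewrite normrM (ger0_norm (x := _^-1)) ?invr_ge0// ltr_pdivrMr//.
    rewrite (le_lt_trans std)// mulrC ltr_pM2r//; lra.
  rewrite (le_trans (dP _ fg _ _ r01 t01 rt))// exprS -mulrA ler_wpM2l//.
  exact: IH.
(* With this [n], [n] pieces of length [d / 2] cover all of $[0,1]$. *)
pose n := Num.bound (d / 2)^-1.
exists (2 ^+ n) => [|f fg s t s01 t01]; first exact: exprn_gt0.
apply: step => //; apply: (@le_trans _ _ 1).
  by rewrite ler_norml; lra.
by rewrite -ler_pdivrMr// mul1r ltW// archi_boundP// invr_ge0 ltW//.
Qed.

End gronwall.

(** * Caratheodory equations: superposition and comparison of solutions *)

Section caratheodory_ode.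
Context (R : realType).
Notation T := (lebesgueR R).
Notation I01 := (`[0%R, 1%R]%classic : set T).
Variables (v : R -> R -> R) (k : R -> R).
Hypothesis mv : forall x, measurable_fun I01 (fun t : T => v t x).
Hypothesis ik : lambda.-integrable I01 (EFin \o k).
Hypothesis v_lip : forall t x y, 0 <= t <= 1 ->
  `|v t x - v t y| <= k t * `|x - y|.
Hypothesis v_growth : forall t x, 0 <= t <= 1 -> `|v t x| <= k t * (1 + `|x|).
Implicit Types (f g : R -> R) (s t x : R).

Let k_ge0 t : 0 <= t <= 1 -> 0 <= k t.
Proof.
by move=> /(v_growth 0)/(le_trans (normr_ge0 _)); rewrite normr0 addr0 mulr1.
Qed.

Let mI01 : measurable I01.
Proof. exact: measurable_itv_lebesgueR. Qed.

(* v_t(g(t)) is the infimum of v_t(q) + k(t) |q - g(t)| over rational q. *)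
Lemma measurable_superposition g : measurable_fun I01 (g : T -> R) ->
  measurable_fun I01 (fun t : T => v t (g t)).
Proof.
move=> mg _; apply: (measurability _ (RGenInftyO.measurableE R)) => //.
move=> /= _ [_ [a ->] <-].
have mk : measurable_fun I01 (k : T -> R).
  by apply/measurable_EFinP; exact: measurable_int ik.
rewrite [X in measurable X](_ : _ = \bigcup_(q : rat)
  (I01 `&` (fun t : T => v t (ratr q) + k t * `|ratr q - g t|) @^-1` `]-oo, a[)).
  apply: bigcupT_measurable_rat => q.
  have mq : measurable_fun I01 (fun t : T => v t (ratr q) + k t * `|ratr q - g t|).
    have m1 := measurable_funB (measurable_cst (ratr q : R)) mg.
    have m2 := measurableT_comp (@normr_measurable R setT) m1.
    exact: measurable_funD (mv (ratr q)) (measurable_funM mk m2).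
  by apply: mq => //; exact: measurable_itv.
apply/seteqP; split => [t [t01 va]|t [q _ [t01 va]]].
  have t01' : 0 <= t <= 1 by move: t01; rewrite /= in_itv.
  have {}va : v t (g t) < a by move: va; rewrite /= in_itv.
  have kt := k_ge0 t01'.
  have k1 : 0 < 2 * k t + 1 by lra.
  (* For [q] within [e] of [g t], the expression is at most $v_t(g(t)) + 2k(t)e = a - e < a$. *)
  pose e := (a - v t (g t)) / (2 * k t + 1).
  have e0 : 0 < e by rewrite divr_gt0// subr_gt0.
  have : g t < g t + e by rewrite ltrDl.
  move=> /rat_in_itvoo[q]; rewrite inE/= => /itvP gq.
  exists q => //; split => //; rewrite /= in_itv/=.
  have qe : `|ratr q - g t| <= e.
    have q1 : g t <= ratr q by rewrite gq.
    have q2 : ratr q <= g t + e by rewrite gq.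
    by rewrite ger0_norm ?subr_ge0//; lra.
  have := le_trans (ler_norm _) (v_lip (ratr q) (g t) t01').
  have := ler_wpM2l kt qe.
  have eE : e * (2 * k t + 1) = a - v t (g t) by rewrite divfK// gt_eqF.
  lra.
have t01' : 0 <= t <= 1 by move: t01; rewrite /= in_itv.
split => //; move: va; rewrite /= !in_itv/= => va; apply: le_lt_trans va.
have := le_trans (ler_norm _) (v_lip (g t) (ratr q) t01').
rewrite distrC; lra.
Qed.

(** The limit of the Picard iterates is at first only known to be measurable and bounded, so
    superpositions are integrated in this class. *)
Definition tame g := measurable_fun I01 (g : T -> R) /\
  exists B, forall t, 0 <= t <= 1 -> `|g t| <= B.

Lemma continuous_tame g : {within `[0, 1], continuous g} -> tame g.
Proof.
move=> cg; split; first exact: within_continuous_measurable.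
exact: within_continuous_bounded.
Qed.

Lemma integrable_superposition g : tame g ->
  lambda.-integrable I01 (EFin \o (fun t => v t (g t))).
Proof.
move=> [mg [B gB]].
apply: (le_integrable _ _ _ (integrableM_bounded (g := cst (1 + B)) ik _
    (B := `|1 + B|) _)) => //.
- by apply/measurable_EFinP; exact: measurable_superposition.
- move=> t; rewrite /= in_itv/= => t01; rewrite lee_fin.
  rewrite (le_trans (v_growth _ t01))// (le_trans _ (ler_norm _))//.
  by rewrite ler_wpM2l ?k_ge0// lerD2l gB.
Qed.

(** Both differences of integrals reduce to one integral over []s, t]], where the Lipschitz bound
    applies. It serves for two solutions and for two successive iterates. *)
Lemma Rintegral_superposition_dist g1 g2 s t : tame g1 -> tame g2 ->
    0 <= s -> s <= t -> t <= 1 ->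
  `|(\int[lambda]_(u in (`[0, t]%classic : set T)) v u (g1 u) -
     \int[lambda]_(u in (`[0, t]%classic : set T)) v u (g2 u)) -
    (\int[lambda]_(u in (`[0, s]%classic : set T)) v u (g1 u) -
     \int[lambda]_(u in (`[0, s]%classic : set T)) v u (g2 u))| <=
  \int[lambda]_(u in (`]s, t]%classic : set T)) (k u * `|g1 u - g2 u|).
Proof.
move=> tg1 tg2 s0 st t1.
have i1 := integrable_superposition tg1; have i2 := integrable_superposition tg2.
rewrite !(Rintegral_itv0_split s0 st t1)// opprD addrACA [X in `|X|]addrAC subrr add0r.
have mst := measurable_itv_lebesgueR `]s, t].
have sub : (`]s, t]%classic : set T) `<=` I01 by exact: subset_itv01.
have j1 := integrable_subitv mst sub i1; have j2 := integrable_subitv mst sub i2.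
rewrite -RintegralB//.
have [m1 [B1 g1B]] := tg1; have [m2 [B2 g2B]] := tg2.
have ikg : lambda.-integrable I01 (EFin \o (fun u => k u * `|g1 u - g2 u|)).
  apply: (integrableM_bounded (B := B1 + B2) ik) => [|u u01].
    exact: measurableT_comp (@normr_measurable R setT) (measurable_funB m1 m2).
  by rewrite normr_id (le_trans (ler_normB _ _))// lerD ?g1B ?g2B.
have j12 : lambda.-integrable (`]s, t]%classic : set T)
    (EFin \o (fun u => v u (g1 u) - v u (g2 u))) by exact: (integrableB mst j1 j2).
rewrite (le_trans (le_normr_Rintegral mst j12))//.
apply: le_Rintegral => //.
- exact: (integrable_abse j12).
- exact: integrable_subitv ikg.
- by move=> u /sub; rewrite /= in_itv/= => u01; exact: v_lip.
Qed.

(** The clauses of [is_solution] for one starting point, which may be any real number. *)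
Definition integral_solution x (y : R -> R) :=
  [/\ {within `[0, 1], continuous y},
      y 0 = x &
      forall t, 0 <= t <= 1 ->
        lambda.-integrable (`[0, t]%classic : set T) (fun s => (v s (y s))%:E) /\
        y t = x + \int[lambda]_(s in (`[0, t]%classic : set T)) v s (y s)].

(** The distance of two solutions varies no more than the difference of their integrals, which the
    Lipschitz bound controls. *)
Lemma integral_solution_gronwall x1 x2 (y1 y2 : R -> R) :
  integral_solution x1 y1 -> integral_solution x2 y2 ->
  gronwall_hyp k (fun t => `|y1 t - y2 t|).
Proof.
move=> [c1 _ e1] [c2 _ e2]; split => //.
  by move=> t; apply: cvg_norm; apply: cvgB; [exact: c1|exact: c2].
move=> s t s0 st t1.
apply: le_trans (Rintegral_superposition_dist
  (continuous_tame c1) (continuous_tame c2) s0 st t1).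
rewrite (le_trans (ler_dist_dist _ _))//.
have t01 : 0 <= t <= 1 by lra.
have s01 : 0 <= s <= 1 by lra.
rewrite [in leLHS](e1 t t01).2 (e1 s s01).2 (e2 t t01).2 (e2 s s01).2.
by rewrite le_eqVlt; apply/orP; left; apply/eqP; congr `|_|; ring.
Qed.

(** * Picard iteration and existence of solutions *)

Lemma continuous_picard_step x g : tame g -> {within `[0, 1],
  continuous (fun t => x + \int[lambda]_(s in (`[0, t]%classic : set T)) v s (g s))}.
Proof.
move=> tg t; apply: cvgD; first exact: cvg_cst.
exact: continuous_indefinite_integral (integrable_superposition tg) _.
Qed.

Fixpoint picard x n : R -> R := if n is m.+1
  then fun t => x + \int[lambda]_(s in (`[0, t]%classic : set T)) v s (picard x m s)
  else cst x.

Lemma continuous_picard x n : {within `[0, 1], continuous (picard x n)}.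
Proof.
elim: n => [|n IH]; first by move=> t; exact: cvg_cst.
exact: continuous_picard_step (continuous_tame IH).
Qed.

Let tame_picard x n := continuous_tame (continuous_picard (x := x) (n := n)).

(* Adding the constant [1 + |x|] makes the first step [v s x] of the iteration,
   of size at most [k s * (1 + |x|)], obey the same bound as the next ones. *)
Definition picard_var x n t : R :=
  1 + `|x| + \sum_(j < n) `|picard x j.+1 t - picard x j t|.

Lemma picard_var0 x : picard_var x 0 = cst (1 + `|x|).
Proof. by apply/funext => t; rewrite /picard_var big_ord0 addr0. Qed.

Lemma picard_varS x n : picard_var x n.+1 =
  (fun t => picard_var x n t + `|picard x n.+1 t - picard x n t|).
Proof. by apply/funext => t; rewrite /picard_var big_ord_recr/= addrA. Qed.

(** Each new term of the sum varies by at most the integral of [k] times the preceding term, so the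
    increments of the sum are bounded through the sum with one term less. That sum is the smaller
    one. *)
Lemma picard_var_gronwall x n : gronwall_hyp k (picard_var x n).
Proof.
have cD m : {within `[0, 1], continuous (fun u => `|picard x m.+1 u - picard x m u|)}.
  move=> u; apply: cvg_norm; apply: cvgB; last exact: continuous_picard.
  exact: (continuous_picard (n := m.+1)).
have cF m : {within `[0, 1], continuous (picard_var x m)}.
  elim: m => [|m IH]; first by rewrite picard_var0 => t; exact: cvg_cst.
  by rewrite picard_varS => t; apply: cvgD; [exact: IH|exact: cD].
have F0 m t : 0 <= picard_var x m t by rewrite addr_ge0// sumr_ge0.
split => // s t s0 st t1.
have mst := measurable_itv_lebesgueR `]s, t].
have sub : (`]s, t]%classic : set T) `<=` I01 by exact: subset_itv01.
have ikc g : {within `[0, 1], continuous g} -> lambda.-integrable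
    (`]s, t]%classic : set T) (EFin \o (fun u => k u * g u)).
  move=> cg; have [mg [B gB]] := continuous_tame cg.
  exact: integrable_subitv (integrableM_bounded ik mg gB).
case: n => [|n].
  rewrite picard_var0 /= subrr normr0; apply: Rintegral_ge0 => u /sub.
  rewrite /= in_itv/= => u01; rewrite mulr_ge0 ?k_ge0//; lra.
(* The induction needs the sharper bound with index [n] in place of [n.+1]. *)
apply: (@le_trans _ _ (\int[lambda]_(u in (`]s, t]%classic : set T))
    (k u * picard_var x n u))); last first.
  apply: le_Rintegral => //; [exact: ikc|exact: ikc|move=> u /sub].
  rewrite /= in_itv/= => u01; rewrite ler_wpM2l ?k_ge0//.
  by rewrite picard_varS lerDl.
elim: n => [|n IH].
  rewrite picard_varS picard_var0 /=.
  have i1 := integrable_superposition (tame_picard x 0).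
  rewrite opprD addrACA subrr add0r (le_trans (ler_dist_dist _ _))//.
  rewrite ![x + _]addrC !addrK (Rintegral_itv0_split s0 st t1)// addrAC subrr add0r.
  have j1 := integrable_subitv mst sub i1.
  rewrite (le_trans (le_normr_Rintegral mst j1))//.
  apply: le_Rintegral => //; first exact: (integrable_abse j1).
    by have := ikc _ (cF 0%N); rewrite picard_var0.
  move=> u /sub; rewrite /= in_itv/= => u01; exact: v_growth.
have distD (a b c d : R) : `|a + b - (c + d)| <= `|a - c| + `|b - d|.
  by rewrite opprD addrACA ler_normD.
rewrite picard_varS; apply: le_trans (distD _ _ _ _) _.
apply: (@le_trans _ _ (\int[lambda]_(u in (`]s, t]%classic : set T))
  (k u * picard_var x n u + k u * `|picard x n.+1 u - picard x n u|))).
  rewrite RintegralD//; [|exact: ikc|exact: ikc].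
  apply: lerD; first exact: IH.
  rewrite (le_trans (ler_dist_dist _ _))//.
  apply: le_trans (Rintegral_superposition_dist (tame_picard x n.+1)
    (tame_picard x n) s0 st t1).
  by rewrite le_eqVlt; apply/orP; left; apply/eqP; congr `|_| => /=; ring.
apply: le_Rintegral => //.
- exact: (integrableD mst (ikc _ (cF n)) (ikc _ (cD n))).
- exact: (ikc _ (cF n.+1)).
- by move=> u _; rewrite -mulrDr picard_varS.
Qed.

(** At time 0 all iterates equal [x], so Gronwall from time 0 bounds the accumulated variation by
    [B], uniformly in [n] and [t]. The iterates are thus partial sums of an absolutely convergent
    series, and dominated convergence passes to the limit in the integral. *)
Lemma integral_solution_exists x : exists y, integral_solution x y.
Proof.
have [C C0 CP] := gronwall k_ge0 ik.
pose B := C * (1 + `|x|).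
have x0 : 0 < 1 + `|x| by rewrite ltr_pwDl.
have sumB n t : 0 <= t <= 1 ->
    \sum_(0 <= j < n) `|picard x j.+1 t - picard x j t| <= B.
  move=> t01; have /CP/(_ 0 t) := picard_var_gronwall x n.
  have picard0 m : picard x m 0 = x.
    case: m => //= m; rewrite Rintegral_itv00 ?addr0//.
    exact: integrable_superposition (tame_picard x m).
  rewrite lexx ler01 => /(_ isT t01).
  rewrite [X in C * X](_ : _ = 1 + `|x|); last first.
    rewrite /picard_var big1 ?addr0// => j _; by rewrite !picard0 subrr normr0.
  rewrite /picard_var big_mkord -/B; lra.
have picardE n t : picard x n t =
    x + series (fun j => picard x j.+1 t - picard x j t) n.
  by rewrite /series/= telescope_sumr// addrC subrK.
have picardB n t : 0 <= t <= 1 -> `|picard x n t| <= `|x| + B.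
  move=> t01; rewrite picardE (le_trans (ler_normD _ _))// lerD2l.
  by rewrite (le_trans (ler_norm_sum _ _ _))// sumB.
have picard_cvg t : 0 <= t <= 1 -> cvgn (fun n => picard x n t).
  move=> t01; under eq_fun do rewrite picardE.
  apply: is_cvgD; first exact: is_cvg_cst.
  apply: normed_cvg; apply: nondecreasing_is_cvgn.
    by apply: nondecreasing_series => i _ _; exact: normr_ge0.
  by exists B => _ [n _ <-]; exact: sumB.
pose y t := limn (fun n => picard x n t).
have yP t : 0 <= t <= 1 -> picard x n t @[n --> \oo] --> y t.
  exact: picard_cvg.
have ty : tame y.
  split.
    apply: (@measurable_fun_cvg _ T R I01 (picard x)).
      by move=> n; case: (tame_picard x n).
    by move=> t; rewrite /= in_itv/=; exact: yP.
  exists (`|x| + B) => t t01.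
  apply: (cvgr_to_le (cvg_norm (yP t t01))).
  by apply: nearW => n; exact: picardB.
have yE t : 0 <= t <= 1 ->
    y t = x + \int[lambda]_(s in (`[0, t]%classic : set T)) v s (y s).
  move=> t01; have mt := measurable_itv_lebesgueR `[0, t].
  have sub : (`[0, t]%classic : set T) `<=` I01 by apply: subset_itv0; case/andP: t01.
  have int_g g : tame g -> lambda.-integrable (`[0, t]%classic : set T)
      (fun s => (v s (g s))%:E).
    by move=> tg; exact: integrable_subitv (integrable_superposition tg).
  have [] := @dominated_convergence _ _ _ lambda _ mt
    (fun n s => (v s (picard x n s))%:E) (fun s => (v s (y s))%:E)
    (fun s => (k s * (1 + (`|x| + B)))%:E).
  - by move=> n; apply: (measurable_int lambda); exact: int_g.
  - by apply: (measurable_int lambda); exact: int_g.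
  - apply: aeW => s /sub; rewrite /= in_itv/= => s01; apply: cvg_EFin.
      by apply: nearW.
    apply/cvgrPdist_lt => e e0.
    (* Adding 1 avoids dividing by zero where [k s] vanishes. *)
    have ks0 : 0 < k s + 1 by rewrite ltr_wpDl// k_ge0.
    have /cvgrPdist_lt/(_ (e / (k s + 1))) := yP s s01.
    rewrite divr_gt0// => /(_ isT); apply: filterS => n.
    rewrite ltr_pdivlMr// mulrC; apply: le_lt_trans.
    by rewrite (le_trans (v_lip _ _ s01))// ler_wpM2r// lerDl.
  - apply: integrable_subitv (integrableM_bounded (g := cst (1 + (`|x| + B))) ik _
      (B := `|1 + (`|x| + B)|) _) => //.
  - apply: aeW => s n /sub; rewrite /= in_itv/= => s01; rewrite lee_fin.
    rewrite (le_trans (v_growth _ s01))// ler_wpM2l ?k_ge0// lerD2l.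
    exact: picardB.
  (* The shifted iterates converge both to [y t] and to the right-hand side of the equation. *)
  have cvgS : picard x n.+1 t @[n --> \oo] --> y t.
    by move: (yP t t01); rewrite -cvg_shiftS.
  move=> _ _ cvg_int; apply: cvg_unique cvgS _ => //.
  apply: cvgD; first exact: cvg_cst.
  apply: fine_cvg.
  rewrite fineK; last exact: integrable_fin_num (int_g _ ty).
  exact: cvg_int.
exists y; split.
(* Continuity of the limit is obtained only now: by the equation, [y] is the Picard step of a tame
   function. *)
- apply: subspace_eq_continuous (continuous_picard_step (x := x) ty).
  by move=> t /set_mem; rewrite /= in_itv/= => /yE.
- rewrite yE ?lexx ?ler01// Rintegral_itv00 ?addr0//.
  exact: integrable_superposition.
- move=> t t01; split; last exact: yE.
  apply: integrable_subitv (integrable_superposition ty).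
    exact: measurable_itv_lebesgueR.
  by apply: subset_itv0; case/andP: t01.
Qed.

End caratheodory_ode.

(** * Existence, uniqueness and the homeomorphism property of the flow *)

Theorem theorem3p1 (R : realType) (K : R -> R -> R) (H : set (R -> R))
    (dot : (R -> R) -> (R -> R) -> R)
    (K_pd : positive_definite_kernel K)
    (H_rkhs : is_rkhs K H dot)
    (H_L2 : contained_in_L2 H)
    (K_bounded : exists M : R, forall x y, `|K x y| <= M)
    (H_lipschitz : exists C1 : R, forall h x y, H h ->
       `|h x - h y| <= C1 * dot_norm dot h * `|x - y|)
    (v : R -> R -> R) (v_X1 : X1 H dot v) :
  exists phi : R -> R -> R,
    [/\ is_solution v phi,
        forall psi, is_solution v psi ->
          forall t x : R, 0 <= t <= 1 -> 0 <= x <= 1 -> psi t x = phi t x &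
        forall t : R, 0 <= t <= 1 ->
          homeomorphism_onto_image (`[0, 1]%classic : set R) (phi t)].
Proof.
have [M KM] := K_bounded; have [C1 HC1] := H_lipschitz.
have [tv ov fin_v] := v_X1.
have mI := @measurable_itv_lebesgueR R `[0, 1].
(* Open rays generate the Borel sets of the line, so open strict sublevel sets of [F] suffice. *)
have meas (F : (R -> R) -> R) : (forall c, tilde_open H dot [set f | F f < c]) ->
    measurable_fun (`[0, 1]%classic : set (lebesgueR R)) (fun t => F (v t)).
  move=> oF _; apply: (measurability _ (RGenInftyO.measurableE R)) => //.
  move=> /= _ [_ [c ->] <-]; rewrite preimage_itvNyo.
  rewrite [X in measurable X](_ : _ = [set t | 0 <= t <= 1 /\ F (v t) < c]).
    exact: (ov _ (oF c)).
  by apply/seteqP; split => t /=; rewrite in_itv.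
have mv x : measurable_fun (`[0, 1]%classic : set (lebesgueR R)) (fun t => v t x).
  by apply: (meas (fun f => f x)) => c; exact: (tilde_open_eval_lt H_rkhs H_L2 KM).
(* A sum of the growth and Lipschitz constants, so that a single [k] serves for both bounds. *)
pose L := (1 + Num.sqrt M) + (1 + `|C1|).
pose k t := L * tilde_norm H dot (v t).
have N0 t : 0 <= t <= 1 -> 0 <= tilde_norm H dot (v t).
  by move=> /tv; exact: (tilde_norm_ge0 H_rkhs H_L2).
have ik : lambda.-integrable (`[0, 1]%classic : set (lebesgueR R)) (EFin \o k).
  apply: (integrableZl mI L (f := EFin \o (fun t => tilde_norm H dot (v t)))).
  apply/integrableP; split.
    apply/measurable_EFinP; apply: meas => c.
    exact: (tilde_open_norm_lt H_rkhs H_L2).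
  apply: le_lt_trans fin_v; rewrite le_eqVlt; apply/orP; left; apply/eqP.
  apply: eq_integral => t; rewrite inE/= in_itv/= => /N0 t0.
  by rewrite ger0_norm.
have v_lip t x y : 0 <= t <= 1 -> `|v t x - v t y| <= k t * `|x - y|.
  move=> t01; apply: le_trans (tilde_lip_le H_rkhs H_L2 x y HC1 (tv t t01)) _.
  rewrite ler_wpM2r// ler_wpM2r ?N0// lerDr addr_ge0 ?sqrtr_ge0//.
have v_growth t x : 0 <= t <= 1 -> `|v t x| <= k t * (1 + `|x|).
  move=> t01; apply: le_trans (tilde_eval_le H_rkhs H_L2 x KM (tv t t01)) _.
  by rewrite mulrAC ler_wpM2r ?addr_ge0// ler_wpM2r ?N0// lerDl addr_ge0.
have [y yP] := choice (integral_solution_exists mv ik v_lip v_growth).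
have k_ge0 t : 0 <= t <= 1 -> 0 <= k t.
  by move=> t01; rewrite mulr_ge0 ?N0// !addr_ge0 ?sqrtr_ge0.
have [C C0 CP] := gronwall k_ge0 ik.
have bound := integral_solution_gronwall mv ik v_lip v_growth.
have zero01 : 0 <= (0 : R) <= 1 by rewrite lexx ler01.
exists (fun t x => y x t); split.
- by move=> x _; exact: yP.
- move=> psi psiP t x t01 x01; have psix : integral_solution v x (psi^~ x) := psiP x x01.
  (* Both solutions start at [x], so their distance is 0 at time 0 and hence at [t]. *)
  have := CP _ (bound _ _ _ _ psix (yP x)) 0 t zero01 t01.
  have [_ -> _] := psix; have [_ -> _] := yP x.
  by rewrite subrr normr0 mulr0 normr_le0 subr_eq0 => /eqP.
(* Gronwall from time 0 to [t] gives the Lipschitz bound for [phi t], and from [t] back to 0 the one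
   for its inverse. *)
- move=> t t01; apply: (bilipschitz_homeomorphism C0) => x1 x2 _ _.
    have := CP _ (bound _ _ _ _ (yP x1) (yP x2)) 0 t zero01 t01.
    by have [_ -> _] := yP x1; have [_ -> _] := yP x2.
  have := CP _ (bound _ _ _ _ (yP x1) (yP x2)) t 0 t01 zero01.
  by have [_ -> _] := yP x1; have [_ -> _] := yP x2.
Qed.
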